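(* Consider the cascaded family of discrete-time systems, parameterized by the sampling period $T>0$, $$x(k+1)=f_T(k,x(k),z(k)),\qquad (\mathrm{X})$$ $$z(k+1)=g_T(k,z(k)),\qquad (\mathrm{Z})$$ with $x\in\mathbb{R}^{n_x}$, $z\in\mathbb{R}^{n_z}$, state $\xi=(x^T\ z^T)^T$, and the auxiliary system $$x(k+1)=f_T(k,x(k),0).\qquad (\mathrm{X}_0)$$ (Semiglobal version) Suppose that the solutions of (X) with input $z$ are USC. Then the cascade (X),(Z) is SP-UAS if and only if the following three conditions hold: (1) the system (X$_0$) is SP-UAS; (2) the system (Z) is SP-UAS; (3) the cascade (X),(Z) is USB. (Global version) Suppose that the solutions of (X) with input $z$ are UGC. Then the cascade (X),(Z) is UGAS if and only if the following three conditions hold: (1) the system (X$_0$) is UGAS; (2) the system (Z) is UGAS; (3) the cascade (X),(Z) is UGB.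
   Context: Notation. $|\cdot|$ is the Euclidean norm. Times $k,k_\circ$ are nonnegative integers. For each $T>0$, $f_T:\mathbb{Z}_{\ge0}\times\mathbb{R}^{n_x}\times\mathbb{R}^{n_z}\to\mathbb{R}^{n_x}$ and $g_T:\mathbb{Z}_{\ge0}\times\mathbb{R}^{n_z}\to\mathbb{R}^{n_z}$. A function $\alpha:\mathbb{R}_{\ge0}\to\mathbb{R}_{\ge0}$ is of class $\mathcal{K}$ if it is continuous, strictly increasing and $\alpha(0)=0$; of class $\mathcal{K}_\infty$ if in addition it is unbounded. A function $\beta:\mathbb{R}_{\ge0}\times\mathbb{R}_{\ge0}\to\mathbb{R}_{\ge0}$ is of class $\mathcal{KL}$ if $\beta(\cdot,t)\in\mathcal{K}$ for every $t\ge0$ and $\beta(s,\cdot)$ is decreasing to zero for every $s>0$. For $L,T>0$, $\ell_{L,T}:=\lfloor L/T\rfloor$. Solutions. For a family of systems $y(k+1)=F_T(k,y(k))$, $y\in\mathbb{R}^n$, $\phi_T^y(k,k_\circ,y_\circ)$ denotes the solution at time $k\ge k_\circ$ starting from $y_\circ$ at time $k_\circ$. When $z$ is regarded as an arbitrary exogenous input sequence in (X), $\phi_T^x(k,k_\circ,x_\circ,\omega^z_{[k_\circ,k)})$ denotes the solution of (X) at time $k$ from $x(k_\circ)=x_\circ$ under the input sequence $\omega^z_{[k_\circ,k)}=\{z(k_\circ),\dots,z(k-1)\}$; $\omega^z:=\omega^z_{[k_\circ,\infty)}$, $|\omega^z|:=\sup_{k\ge k_\circ}|z(k)|$; and $\phi_T^x(k,k_\circ,x_\circ,0)$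 is the solution for $z\equiv0$, i.e. the solution of (X$_0$). SP-UAS / UGAS. The family $y(k+1)=F_T(k,y(k))$ is semiglobally practically uniformly asymptotically stable (SP-UAS) if there exists $\beta\in\mathcal{KL}$ such that for any $\Delta,\nu>0$ there exists $T^*>0$ such that for all $k_\circ\ge0$, $|y_\circ|\le\Delta$, $T\in(0,T^* )$ and $k\ge k_\circ$: $|\phi_T^y(k,k_\circ,y_\circ)|\le\max\{\beta(|y_\circ|,(k-k_\circ)T),\nu\}$. It is uniformly globally asymptotically stable (UGAS) if there exist $\beta\in\mathcal{KL}$ and $T^*>0$ such that for all $k_\circ\ge0$, $y_\circ\in\mathbb{R}^n$, $T\in(0,T^* )$ and $k\ge k_\circ$: $|\phi_T^y(k,k_\circ,y_\circ)|\le\beta(|y_\circ|,(k-k_\circ)T)$. USB / UGB. The family $y(k+1)=F_T(k,y(k))$ is uniformly semiglobally bounded (USB) if there exist $\kappa\in\mathcal{K}_\infty$ and a constant $c$ such that for any $\Delta>0$ there exists $T^*>0$ such that for all $k_\circ\ge0$, $|y_\circ|\le\Delta$, $T\in(0,T^* )$ and $k\ge k_\circ$: $|\phi_T^y(k,k_\circ,y_\circ)|\le\kappa(|y_\circ|)+c$. It is uniformly globally bounded (UGB) if there exist $\kappa\in\mathcal{K}_\infty$, $c$ and $T^*>0$ such that this inequality holds for all $k_\circ\ge0$, $y_\circ\in\mathbb{R}^n$, $T\in(0,T^* )$ and $k\ge k_\circ$. USC / UGC. The solutions of (X) with input $z$ are uniformly semiglobally continuous (USC) if for any $\Delta>0$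 there exists $T^*>0$ such that for any $\eta\in(0,\Delta)$, $\epsilon>0$, $L>0$ there exists $\mu>0$ such that for all $T\in(0,T^* )$, all input sequences $z$ with $|\omega^z|\le\mu$, all $k_\circ\ge0$ and all $|x_\circ|\le\eta$: $|\phi_T^x(k,k_\circ,x_\circ,\omega^z_{[k_\circ,k)})-\phi_T^x(k,k_\circ,x_\circ,0)|\le\epsilon$ for all integers $k\in[k_\circ,k_\circ+\ell_{L,T}]$. They are uniformly globally continuous (UGC) if there exists $T^*>0$ such that for any $\eta>0$, $\epsilon>0$, $L>0$ there exists $\mu>0$ such that the same conclusion holds for all $T\in(0,T^* )$, all $z$ with $|\omega^z|\le\mu$, all $k_\circ\ge0$ and all $|x_\circ|\le\eta$. *)

(* Defs.v *)
(* MathComp-Analysis, over an arbitrary [R : realType]. *)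
From HB Require Import structures.
From mathcomp Require Import all_boot all_order all_algebra.
From mathcomp Require Import all_classical all_reals all_analysis.

Set Implicit Arguments.
Unset Strict Implicit.
Unset Printing Implicit Defensive.

Import Order.TTheory GRing.Theory Num.Theory.
Import numFieldNormedType.Exports.

Local Open Scope classical_set_scope.
Local Open Scope ring_scope.

Section Comparison.
Variable R : realType.

(* Functions on [0, +oo[ are represented by functions on R whose values at
   negative arguments are irrelevant. Nonnegativity on [0, +oo[ is a
   consequence of [alpha 0 = 0] and monotonicity. *)
Definition classK (alpha : R -> R) : Prop :=
  [/\ {within `[0, +oo[, continuous alpha},
      {in `[0, +oo[ &, {homo alpha : s t / s < t}}
    & alpha 0 = 0].

Definition classKoo (alpha : R -> R) : Prop :=
  classK alpha /\ (forall M : R, exists2 s : R, 0 <= s & M < alpha s).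

(* "Decreasing to zero" is read as nonincreasing with limit zero. *)
Definition classKL (beta : R -> R -> R) : Prop :=
  (forall t : R, 0 <= t -> classK (beta ^~ t)) /\
  (forall s : R, 0 < s ->
     {in `[0, +oo[ &, {homo beta s : t u / t <= u >-> u <= t}} /\
     beta s t @[t --> +oo] --> (0 : R)).

End Comparison.

Section Systems.
Variable R : realType.

(* The norm [`| _ |] carried by matrices in the library is the sup norm. *)
Definition enorm (n : nat) (v : 'cV[R]_n) : R :=
  Num.sqrt (\sum_i v i ord0 ^+ 2).

(* A family T |-> F_T of time-varying maps; only T > 0 is ever used. *)
Definition family (n : nat) : Type := R -> nat -> 'cV[R]_n -> 'cV[R]_n.

(* State at time k >= k0 of y(k+1) = F(k, y(k)), y(k0) = y0. *)
Definition phi (n : nat) (F : nat -> 'cV[R]_n -> 'cV[R]_n) (k k0 : nat)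
    (y0 : 'cV[R]_n) : 'cV[R]_n :=
  iteri (k - k0) (fun j => F (k0 + j)%N) y0.

Lemma phi_init n (F : nat -> 'cV[R]_n -> 'cV[R]_n) k0 y0 :
  phi F k0 k0 y0 = y0.
Proof. by rewrite /phi subnn. Qed.

Lemma phi_step n (F : nat -> 'cV[R]_n -> 'cV[R]_n) k k0 y0 :
  (k0 <= k)%N -> phi F k.+1 k0 y0 = F k (phi F k k0 y0).
Proof. by move=> le_k0k; rewrite /phi subSn //= subnKC. Qed.

Definition SP_UAS (n : nat) (F : family n) : Prop :=
  exists2 beta : R -> R -> R, classKL beta &
    forall Delta nu : R, 0 < Delta -> 0 < nu ->
    exists2 Tstar : R, 0 < Tstar &
      forall (k0 : nat) (y0 : 'cV[R]_n) (T : R) (k : nat),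
        enorm y0 <= Delta -> 0 < T < Tstar -> (k0 <= k)%N ->
        enorm (phi (F T) k k0 y0)
          <= Num.max (beta (enorm y0) ((k - k0)%:R * T)) nu.

Definition UGAS (n : nat) (F : family n) : Prop :=
  exists2 beta : R -> R -> R, classKL beta &
    exists2 Tstar : R, 0 < Tstar &
      forall (k0 : nat) (y0 : 'cV[R]_n) (T : R) (k : nat),
        0 < T < Tstar -> (k0 <= k)%N ->
        enorm (phi (F T) k k0 y0) <= beta (enorm y0) ((k - k0)%:R * T).

Definition USB (n : nat) (F : family n) : Prop :=
  exists2 kappa : R -> R, classKoo kappa &
  exists c : R,
    forall Delta : R, 0 < Delta ->
    exists2 Tstar : R, 0 < Tstar &
      forall (k0 : nat) (y0 : 'cV[R]_n) (T : R) (k : nat),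
        enorm y0 <= Delta -> 0 < T < Tstar -> (k0 <= k)%N ->
        enorm (phi (F T) k k0 y0) <= kappa (enorm y0) + c.

Definition UGB (n : nat) (F : family n) : Prop :=
  exists2 kappa : R -> R, classKoo kappa &
  exists c : R,
    exists2 Tstar : R, 0 < Tstar &
      forall (k0 : nat) (y0 : 'cV[R]_n) (T : R) (k : nat),
        0 < T < Tstar -> (k0 <= k)%N ->
        enorm (phi (F T) k k0 y0) <= kappa (enorm y0) + c.

Definition input_norm (m : nat) (w : nat -> 'cV[R]_m) (k0 : nat) : \bar R :=
  ereal_sup [set (enorm (w k))%:E | k in [set k | (k0 <= k)%N]].

Section Cascade.
Variables nx nz : nat.
Variable f : R -> nat -> 'cV[R]_nx -> 'cV[R]_nz -> 'cV[R]_nx.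

(* Only the values w(k0), ..., w(k-1) of the input are used. *)
Definition phix (T : R) (k k0 : nat) (x0 : 'cV[R]_nx)
    (w : nat -> 'cV[R]_nz) : 'cV[R]_nx :=
  phi (fun i x => f T i x (w i)) k k0 x0.

Definition zero_input_sys : family nx := fun T k x => f T k x 0.

Definition cascade_sys (g : family nz) : family (nx + nz) :=
  fun T k xi =>
    col_mx (f T k (usubmx xi) (dsubmx xi)) (g T k (dsubmx xi)).

Definition close_to_zero_input (Tstar eta eps L mu : R) : Prop :=
  forall (T : R) (w : nat -> 'cV[R]_nz) (k0 : nat) (x0 : 'cV[R]_nx),
    0 < T < Tstar -> (input_norm w k0 <= mu%:E)%E -> enorm x0 <= eta ->
    forall k : nat,
      (k0 <= k)%N -> k%:Z <= k0%:Z + Num.floor (L / T) ->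
      enorm (phix T k k0 x0 w - phix T k k0 x0 (fun=> 0)) <= eps.

Definition USC : Prop :=
  forall Delta : R, 0 < Delta ->
  exists2 Tstar : R, 0 < Tstar &
    forall eta eps L : R, 0 < eta < Delta -> 0 < eps -> 0 < L ->
    exists2 mu : R, 0 < mu & close_to_zero_input Tstar eta eps L mu.

Definition UGC : Prop :=
  exists2 Tstar : R, 0 < Tstar &
    forall eta eps L : R, 0 < eta -> 0 < eps -> 0 < L ->
    exists2 mu : R, 0 < mu & close_to_zero_input Tstar eta eps L mu.

End Cascade.
End Systems.

(* Main.v *)
(** If the driving state [z] is uniformly small, continuity with respect to the
    input keeps [x] close, on windows of a fixed length [L], to the trajectory
    of the unforced system; choosing [L] so long that the unforced system brings
    the ball of radius Delta into a small ball by time about [L] lets the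
    comparison be restarted window after window, so [x] obeys a KL estimate up
    to an arbitrarily small error for all times. Applied from the initial time
    this gives stability of the cascade; applied after [z] has decayed, from a
    state controlled by the boundedness hypothesis, it gives attractivity. A KL
    function is then rebuilt from stability, boundedness and attractivity. The
    converse for the unforced system compares it with the cascade by the same
    window argument. *)
Require Import Defs.
From HB Require Import structures.
From mathcomp Require Import all_boot all_order all_algebra.
From mathcomp Require Import all_classical all_reals all_analysis.
From mathcomp Require Import ring lra.

Set Implicit Arguments.
Unset Strict Implicit.
Unset Printing Implicit Defensive.

Import Order.TTheory GRing.Theory Num.Theory.
Import numFieldNormedType.Exports.

Local Open Scope classical_set_scope.
Local Open Scope ring_scope.

(** * Estimates for comparison functions *)

Section KLFunctions.
Variable R : realType.
Implicit Types (beta : R -> R -> R) (s t eps : R).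

Lemma KL0 beta t : classKL beta -> 0 <= t -> beta 0 t = 0.
Proof. by move=> [K _] /K[]. Qed.

Lemma KL_le beta s s' t t' : classKL beta ->
  0 <= s -> s <= s' -> 0 <= t' -> t' <= t -> beta s t <= beta s' t'.
Proof.
move=> hb s0 ss' t'0 t't; have t0 := le_trans t'0 t't.
have [_ mono _] := hb.1 _ t0.
apply: (@le_trans _ _ (beta s' t)).
  move: ss'; rewrite le_eqVlt => /predU1P[->//|ss'].
  by apply/ltW/mono; rewrite ?in_itv/= ?andbT ?(le_trans s0 (ltW ss')).
(* Monotonicity in time is only given for positive radii, so radius zero is split off. *)
have [->|s'0] := eqVneq s' 0; first by rewrite !KL0.
apply: (hb.2 s' _).1; rewrite ?in_itv/= ?andbT//.
by rewrite lt_def s'0 (le_trans s0).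
Qed.

Lemma KL_ge0 beta s t : classKL beta -> 0 <= s -> 0 <= t -> 0 <= beta s t.
Proof. by move=> hb s0 t0; rewrite -(KL0 hb t0); apply: KL_le. Qed.

Lemma KL_small beta eps : classKL beta -> 0 < eps ->
  exists2 delta, 0 < delta & beta delta 0 <= eps.
Proof.
move=> hb e0; have [cont _ b0] := hb.1 0 (lexx 0).
have [_ /cvgrPdist_le/(_ _ e0) near0] := (continuous_within_itvcyP _ _).1 cont.
have : \forall s \near (0:R)^'+, 0 < s /\ beta s 0 <= eps.
  near=> s; have s0 : 0 < s by near: s; exact: nbhs_right_gt.
  split=> //; have : `|beta 0 0 - beta s 0| <= eps by near: s.
  by rewrite b0 sub0r normrN ger0_norm ?KL_ge0// ltW.
by move=> /filter_ex[s []]; exists s.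
Unshelve. all: by end_near. Qed.

Lemma KL_vanish beta s eps : classKL beta -> 0 <= s -> 0 < eps ->
  exists2 tau, 0 < tau & beta s tau <= eps.
Proof.
move=> hb; rewrite le_eqVlt => /predU1P[<-|s0] e0.
  by exists 1; rewrite ?KL0// ltW.
have [_ /cvgr0Pnorm_le/(_ _ e0) neary] := hb.2 s s0.
have : \forall t \near +oo, 0 < t /\ beta s t <= eps.
  near=> t; have t0 : 0 < t by near: t; apply: nbhs_pinfty_gt; rewrite num_real.
  split=> //; have : `|beta s t| <= eps by near: t.
  by rewrite ger0_norm// KL_ge0// ltW.
by move=> /filter_ex[t []]; exists t.
Unshelve. all: by end_near. Qed.

Lemma KL_scale beta (c : R) : 0 < c -> classKL beta ->
  classKL (fun s t => c * beta s t).
Proof.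
move=> c0 hb; split=> [t t0|s s0].
  have [cont mono b0] := hb.1 t t0; split.
  - move=> x; apply: cvgM; [exact: cvg_cst|exact: cont].
  - by move=> x y x0 y0 xy; rewrite ltr_pM2l// mono.
  - by rewrite b0 mulr0.
have [mono lim] := hb.2 s s0; split=> [t u t0 u0 tu|].
  by rewrite ler_pM2l// mono.
by rewrite -[X in _ --> X](mulr0 c); apply: cvgM => //; exact: cvg_cst.
Qed.

(** [beta ^~ 0] is of class K but may be bounded; the summand [s] makes it unbounded. *)
Lemma KL_Koo beta : classKL beta -> classKoo (fun s => beta s 0 + s).
Proof.
move=> hb; have [cont mono b0] := hb.1 0 (lexx 0); split.
  split.
  - move=> x; apply: cvgD; first exact: cont.
    by apply: (@continuous_subspaceT _ _ _ id) => y; exact: cvg_id.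
  - by move=> x y x0 y0 xy; rewrite ltrD// mono.
  - by rewrite b0 addr0.
move=> M; exists (`|M| + 1); first by rewrite addr_ge0.
apply: (@lt_le_trans _ _ (`|M| + 1)).
  by rewrite (le_lt_trans (ler_norm M))// ltrDl.
by rewrite lerDr KL_ge0// addr_ge0.
Qed.

Lemma Koo_le (kappa : R -> R) s s' :
  classKoo kappa -> 0 <= s -> s <= s' -> kappa s <= kappa s'.
Proof.
move=> [[_ mono _] _] s0; rewrite le_eqVlt => /predU1P[->//|ss'].
by apply/ltW/mono; rewrite ?in_itv/= ?andbT// (le_trans s0)// ltW.
Qed.

End KLFunctions.

(** * The Euclidean norm and its behaviour on stacked vectors *)

Section EuclideanNorm.
Variable R : realType.

Lemma enorm_ge0 n (v : 'cV[R]_n) : 0 <= enorm v.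
Proof. exact: sqrtr_ge0. Qed.

Lemma enorm0 n : enorm (0 : 'cV[R]_n) = 0.
Proof.
by rewrite /enorm big1 ?sqrtr0// => i _; rewrite mxE expr0n.
Qed.

Lemma enormN n (v : 'cV[R]_n) : enorm (- v) = enorm v.
Proof. by congr Num.sqrt; apply: eq_bigr => i _; rewrite mxE sqrrN. Qed.

Lemma sqr_enorm n (v : 'cV[R]_n) : enorm v ^+ 2 = \sum_i v i ord0 ^+ 2.
Proof. by rewrite sqr_sqrtr// sumr_ge0// => i _; rewrite sqr_ge0. Qed.

Lemma enorm_eq0 n (v : 'cV[R]_n) : enorm v = 0 -> v = 0.
Proof.
move=> v0; have := sqr_enorm v; rewrite v0 expr0n/= => /esym/eqP.
rewrite psumr_eq0 => [/allP h|i _]; last by rewrite sqr_ge0.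
apply/colP => i; rewrite mxE; apply/eqP; rewrite -sqrf_eq0.
by have := h i (mem_index_enum i).
Qed.

Lemma enormD n (u v : 'cV[R]_n) : enorm (u + v) <= enorm u + enorm v.
Proof.
have [/enorm_eq0->|u0] := eqVneq (enorm u) 0.
  by rewrite add0r enorm0 add0r.
have [/enorm_eq0->|v0] := eqVneq (enorm v) 0.
  by rewrite addr0 enorm0 addr0.
have {}u0 : 0 < enorm u by rewrite lt_def u0 enorm_ge0.
have {}v0 : 0 < enorm v by rewrite lt_def v0 enorm_ge0.
(* Cauchy-Schwarz: multiplied by the product of the norms, the defect is half the sum of the squares
   of [enorm v * u i ord0 - enorm u * v i ord0]. *)
have cs : \sum_i u i ord0 * v i ord0 <= enorm u * enorm v.
  rewrite -(ler_pM2l (mulr_gt0 u0 v0)) -subr_ge0.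
  suff -> : enorm u * enorm v * (enorm u * enorm v) -
      enorm u * enorm v * \sum_i u i ord0 * v i ord0 =
      2^-1 * \sum_i (enorm v * u i ord0 - enorm u * v i ord0) ^+ 2.
    by rewrite mulr_ge0// sumr_ge0// => i _; rewrite sqr_ge0.
  under [in RHS]eq_bigr => i _.
    rewrite (_ : _ ^+ 2 = enorm v ^+ 2 * u i ord0 ^+ 2 +
      (enorm u ^+ 2 * v i ord0 ^+ 2
       - (2 * (enorm u * enorm v)) * (u i ord0 * v i ord0))); last by ring.
    over.
  rewrite big_split/= sumrB -!mulr_sumr -!sqr_enorm.
  by field.
rewrite -(@ler_pXn2r _ 2)// ?nnegrE ?addr_ge0 ?enorm_ge0//.
rewrite sqr_enorm sqrrD !sqr_enorm.
under eq_bigr => i _ do rewrite mxE sqrrD.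
by rewrite !big_split/= lerD2r lerD2l mulr2n lerD.
Qed.

Lemma enorm_usubmx m n (v : 'cV[R]_(m + n)) : enorm (usubmx v) <= enorm v.
Proof.
rewrite ler_wsqrtr// big_split_ord/= ler_wpDr ?sumr_ge0//.
  by move=> i _; rewrite sqr_ge0.
by apply: ler_sum => i _; rewrite mxE.
Qed.

Lemma enorm_dsubmx m n (v : 'cV[R]_(m + n)) : enorm (dsubmx v) <= enorm v.
Proof.
rewrite ler_wsqrtr// big_split_ord/= ler_wpDl ?sumr_ge0//.
  by move=> i _; rewrite sqr_ge0.
by apply: ler_sum => i _; rewrite mxE.
Qed.

Lemma enorm_col0mx m n (v : 'cV[R]_n) : enorm (col_mx (0 : 'cV_m) v) = enorm v.
Proof.
congr Num.sqrt; rewrite big_split_ord/= big1 ?add0r => [|i _].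
  by apply: eq_bigr => i _; rewrite col_mxEd.
by rewrite col_mxEu mxE expr0n.
Qed.

Lemma enorm_colmx0 m n (u : 'cV[R]_m) : enorm (col_mx u (0 : 'cV_n)) = enorm u.
Proof.
congr Num.sqrt; rewrite big_split_ord/= [X in _ + X]big1 ?addr0 => [|i _].
  by apply: eq_bigr => i _; rewrite col_mxEu.
by rewrite col_mxEd mxE expr0n.
Qed.

Lemma enorm_col_mx m n (u : 'cV[R]_m) (v : 'cV[R]_n) :
  enorm (col_mx u v) <= enorm u + enorm v.
Proof.
rewrite -[u]addr0 -[v in col_mx _ v]add0r -add_col_mx.
by rewrite (le_trans (enormD _ _))// enorm_colmx0 enorm_col0mx addr0.
Qed.

End EuclideanNorm.

(** * Dominating a monotone, possibly discontinuous gain by a KL function *)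

Section KLEnvelope.
Variables (R : realType) (psi : R -> R -> R).
Hypothesis psi_ge0 : forall s t, 0 < s -> 0 <= t -> 0 <= psi s t.
Hypothesis psi_le : forall s s' t t', 0 < s -> s <= s' -> 0 <= t' -> t' <= t ->
  psi s t <= psi s' t'.
Hypothesis psi_small : forall eps, 0 < eps ->
  exists2 delta, 0 < delta & psi delta 0 <= eps.
Hypothesis psi_vanish : forall s eps, 0 < s -> 0 < eps ->
  exists2 tau, 0 <= tau & psi s tau <= eps.

(* A Lipschitz cutoff in [s], equal to 1 for [u <= s] and to 0 for
   [2 * s <= u]. *)
Let cut (s u : R) : R := Num.max 0 (Num.min 1 (2 * (s / u) - 1)).

Let cut_ge0 s u : 0 <= cut s u. Proof. by rewrite le_max lexx. Qed.

Let cut_le1 s u : cut s u <= 1.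
Proof. by rewrite ge_max ler01 ge_min lexx. Qed.

Let cut1 s u : 0 < u -> u <= s -> cut s u = 1.
Proof.
move=> u0 us; have : 1 <= s / u by rewrite ler_pdivlMr// mul1r.
by rewrite /cut => h; rewrite min_l ?max_r//; lra.
Qed.

Let cut0 s u : 0 < u -> 2 * s <= u -> cut s u = 0.
Proof.
move=> u0 us; have : 2 * (s / u) <= 1 by rewrite mulrA ler_pdivrMr// mul1r.
by rewrite /cut => h; rewrite max_l// ge_min; apply/orP; right; lra.
Qed.

Let cut_homo s s' u : 0 < u -> s <= s' -> cut s u <= cut s' u.
Proof.
move=> u0 ss'; have : s / u <= s' / u by rewrite ler_pM2r ?invr_gt0.
by move=> h; rewrite /cut le_max2 ?le_min2//; lra.
Qed.

(** For [u <= s] the cutoff already equals 1; for [u > s] its slope in [s] is at most [2 / u], hence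
    below [2 / s]. The constant is thus uniform in [u]. *)
Let cut_lip s s' u : 0 < s -> 0 < u -> s <= s' ->
  cut s' u <= cut s u + 2 * ((s' - s) / s).
Proof.
move=> s0 u0 ss'; have [us|su] := leP u s.
  rewrite (cut1 u0 us) (le_trans (cut_le1 _ _))// lerDl.
  by rewrite !mulr_ge0// ?subr_ge0// invr_ge0 ltW.
have : (s' - s) / u <= (s' - s) / s.
  by rewrite ler_wpM2l ?subr_ge0// lef_pV2 ?posrE// ltW.
have : 0 <= (s' - s) / s by rewrite divr_ge0 ?subr_ge0// ltW.
have : 0 <= (s' - s) / u by rewrite divr_ge0 ?subr_ge0// ltW.
rewrite [(s' - s) / u]mulrBl => qq' d0 qd.
rewrite ge_max addr_ge0 ?cut_ge0 ?(mulr_ge0 (ler0n _ 2) d0)//=.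
rewrite (@le_trans _ _ (Num.min 1 (2 * (s / u) - 1) + 2 * ((s' - s) / s)))//.
  by rewrite ge_min; case: (leP 1 (2 * (s / u) - 1)) => ?; apply/orP;
    [left|right]; lra.
by rewrite lerD2r le_max lexx orbT.
Qed.

(** A regularization of [psi] in its first argument: for [s > 0] it lies between [psi s t] and
    [psi (2 * s) t], and it inherits the Lipschitz bounds of the cutoff even where [psi] jumps. *)
Let env (s t : R) : R := sup [set psi u t * cut s u | u in [set u | 0 < u]].

Let env_le s t M : (forall u, 0 < u -> psi u t * cut s u <= M) -> env s t <= M.
Proof.
move=> h; apply: ge_sup; last by move=> _ [u u0 <-]; exact: h.
by exists (psi 1 t * cut s 1), 1 => //=.
Qed.

Let term_le s t u : 0 < s -> 0 <= t -> 0 < u ->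
  psi u t * cut s u <= psi (2 * s) t.
Proof.
move=> s0 t0 u0; have s20 : 0 < 2 * s by rewrite mulr_gt0.
have [us|/ltW su] := leP u (2 * s); last by rewrite cut0// mulr0 psi_ge0.
by rewrite (le_trans _ (psi_le u0 us t0 (lexx t)))// ler_piMr// psi_ge0.
Qed.

Let env_ge s t u : 0 <= t -> 0 < u -> psi u t * cut s u <= env s t.
Proof.
move=> t0 u0; apply: ub_le_sup; last by exists u.
have [s0|s0] := ltP 0 s.
  by exists (psi (2 * s) t) => _ [v v0 <-]; exact: term_le.
exists 0 => _ [v v0 <-]; rewrite cut0 ?mulr0// (le_trans _ (ltW v0))//.
by rewrite mulr_ge0_le0.
Qed.

Let env_ge0 s t : 0 <= t -> 0 <= env s t.
Proof.
by move=> t0; rewrite (le_trans _ (env_ge s t0 ltr01))// mulr_ge0// psi_ge0.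
Qed.

Let env_homo s s' t : 0 <= t -> s <= s' -> env s t <= env s' t.
Proof.
move=> t0 ss'; apply: env_le => u u0.
by rewrite (le_trans _ (env_ge s' t0 u0))// ler_wpM2l ?psi_ge0// cut_homo.
Qed.

(** Only radii [u <= 2 * s'] contribute to [env s' t], so each weight [psi u t] is at most
    [psi (2 * s') t]. *)
Let env_lip s s' t : 0 < s -> 0 <= t -> s <= s' ->
  env s' t <= env s t + psi (2 * s') t * (2 * ((s' - s) / s)).
Proof.
move=> s0 t0 ss'; have s'0 : 0 < s' by exact: lt_le_trans ss'.
have d0 : 0 <= 2 * ((s' - s) / s).
  by rewrite mulr_ge0// divr_ge0 ?subr_ge0// ltW.
apply: env_le => u u0; have [us|/ltW su] := leP u (2 * s'); last first.
  by rewrite cut0// mulr0 addr_ge0 ?env_ge0// mulr_ge0 ?psi_ge0// mulr_gt0.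
rewrite (@le_trans _ _ (psi u t * (cut s u + 2 * ((s' - s) / s))))//.
  by rewrite ler_wpM2l ?psi_ge0// cut_lip.
by rewrite mulrDr lerD ?env_ge// ler_wpM2r// psi_le.
Qed.

Let env_eq0 s t : 0 <= t -> s <= 0 -> env s t = 0.
Proof.
move=> t0 s0; apply/eqP; rewrite eq_le env_ge0// andbT; apply: env_le => u u0.
by rewrite cut0 ?mulr0// (le_trans _ (ltW u0))// mulr_ge0_le0.
Qed.

Let env_le_psi s t : 0 < s -> 0 <= t -> env s t <= psi (2 * s) t.
Proof. by move=> s0 t0; apply: env_le => u; exact: term_le. Qed.

Let env_continuous t : 0 <= t -> {in `]0, +oo[, continuous (env ^~ t)}.
Proof.
move=> t0 s; rewrite in_itv/= andbT => s0.
(* A Lipschitz constant on the interval from [s / 2] to [2 * s]: there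
   [psi (2 * r') t <= psi (4 * s) t] and [2 / r <= 4 / s]. *)
pose C := psi (4 * s) t * (4 / s).
have C0 : 0 <= C by rewrite mulr_ge0 ?divr_ge0 ?psi_ge0 ?mulr_gt0 ?(ltW s0).
have near_le r r' : s / 2 <= r -> r <= r' -> r' <= 2 * s ->
    env r' t - env r t <= C * (r' - r).
  move=> sr rr' r's; have r0 : 0 < r by rewrite (lt_le_trans _ sr)// divr_gt0.
  have r'0 : 0 < r' by exact: lt_le_trans rr'.
  rewrite lerBlDl (le_trans (env_lip r0 t0 rr'))// lerD2l /C -mulrA.
  apply: ler_pM; rewrite ?psi_ge0 ?mulr_gt0//.
  - by rewrite mulr_ge0// divr_ge0 ?subr_ge0// ltW.
  - by apply: psi_le; rewrite ?mulr_gt0//; lra.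
  rewrite mulrCA mulrC ler_wpM2r ?subr_ge0//.
  rewrite ler_pdivlMr// mulrAC ler_pdivrMr//; lra.
apply/cvgrPdist_le => eps e0; near=> r.
have rs : `|s - r| < s / 2 by near: r; apply: cvgr_dist_lt; rewrite ?divr_gt0.
(* Dividing by [C + 1] avoids the case where [C] vanishes. *)
have re : `|s - r| < eps / (C + 1).
  by near: r; apply: cvgr_dist_lt; rewrite ?divr_gt0 ?ltr_wpDl.
have -> : eps = (C + 1) * (eps / (C + 1)).
  by rewrite mulrC divfK// gt_eqF// ltr_wpDl.
apply: (@le_trans _ _ (C * `|s - r|)); last first.
  by apply: ler_pM => //; [rewrite lerDl|exact: ltW].
move: rs; rewrite ltr_norml => /andP[rs1 rs2].
have [sr|/ltW rs] := leP s r.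
  rewrite !ler0_norm ?subr_le0 ?env_homo// !opprB near_le//; lra.
rewrite !ger0_norm ?subr_ge0 ?env_homo// near_le//; lra.
Unshelve. all: by end_near. Qed.

(** The summand [s / (1 + t)] makes the monotone [env] strictly increasing in [s] and tends to zero
    in [t]. Continuity at zero and decay come from [psi (2 * s) t], which dominates [env s t]. *)
Lemma KL_envelope : exists2 beta, classKL beta &
  forall s t, 0 < s -> 0 <= t -> psi s t <= beta s t.
Proof.
exists (fun s t => env s t + s / (1 + t)); last first.
  move=> s t s0 t0; rewrite -[leLHS]addr0 lerD//.
    by rewrite (le_trans _ (env_ge s t0 s0))// cut1// mulr1.
  by rewrite divr_ge0 ?addr_ge0// ltW.
split=> [t t0|s s0]; last split.
- have t10 : 0 < 1 + t by rewrite ltr_pwDl.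
  split; last by rewrite env_eq0// mul0r addr0.
  + apply/continuous_within_itvcyP; split=> [s s0|].
      by apply: cvgD; [exact: env_continuous|exact: mulrr_continuous].
    rewrite env_eq0// mul0r; apply/cvgrPdist_le => eps e0.
    have [d d0 psid] := psi_small (divr_gt0 e0 (ltr0Sn _ 1)).
    near=> s.
    have s0 : 0 < s by near: s; exact: nbhs_right_gt.
    have sd : s < d / 2 by near: s; apply: nbhs_right_lt; rewrite divr_gt0.
    have se : s < eps / 2 by near: s; apply: nbhs_right_lt; rewrite divr_gt0.
    rewrite add0r sub0r normrN ger0_norm; last first.
      by rewrite addr_ge0 ?env_ge0// divr_ge0 ?ltW.
    have : env s t <= eps / 2.
      rewrite (le_trans (env_le_psi s0 t0))// (le_trans _ psid)//.
      by apply: psi_le; rewrite ?mulr_gt0//; lra.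
    have : s / (1 + t) <= s by rewrite ler_pdivrMr// ler_peMr ?lerDl// ltW.
    by lra.
  + move=> x y x0 y0 xy; apply: ler_ltD; first by rewrite env_homo// ltW.
    by rewrite ltr_pM2r ?invr_gt0.
- move=> t u; rewrite !in_itv/= !andbT => t0 u0 tu; apply: lerD.
    apply: env_le => v v0; rewrite (le_trans _ (env_ge s t0 v0))//.
    by rewrite ler_wpM2r// psi_le.
  by rewrite ler_wpM2l ?(ltW s0)// lef_pV2 ?posrE ?ltr_pwDl// lerD2l.
- apply/cvgr0Pnorm_le => eps e0.
  have [tau tau0 psitau] :=
    psi_vanish (mulr_gt0 (ltr0Sn R 1) s0) (divr_gt0 e0 (ltr0Sn _ 1)).
  near=> t.
  have t0 : 0 < t by near: t; apply: nbhs_pinfty_gt; rewrite num_real.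
  have taut : tau <= t by near: t; apply: nbhs_pinfty_ge; rewrite num_real.
  have st : s / (eps / 2) <= t.
    by near: t; apply: nbhs_pinfty_ge; rewrite num_real.
  have t10 : 0 < 1 + t by rewrite addr_gt0.
  have n0 : 0 <= env s t + s / (1 + t).
    by rewrite addr_ge0 ?env_ge0 ?divr_ge0 ?ltW.
  rewrite (ger0_norm n0).
  have : env s t <= eps / 2.
    rewrite (le_trans (env_le_psi s0 (ltW t0)))// (le_trans _ psitau)//.
    by rewrite psi_le// mulr_gt0.
  have : s / (1 + t) <= eps / 2.
    rewrite ler_pdivrMr//; move: st; rewrite ler_pdivrMr ?divr_gt0//.
    by lra.
  by move=> st2 env2; rewrite [leRHS]splitr lerD.
Unshelve. all: by end_near. Qed.

End KLEnvelope.

(** * A KL estimate from boundedness, stability and attractivity *)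

Section KLOfBounds.
Variables (R : realType) (F : set_system R).
Context {FF : Filter F}.
(** Intended reading of [B T s t e]: with sampling period [T], every trajectory starting in the ball
    of radius [s] is bounded by [e] from elapsed time [t] on. *)
Variable B : R -> R -> R -> R -> Prop.
Hypothesis B_mono : forall T s s' t t' e e', s <= s' -> t' <= t -> e' <= e ->
  B T s' t' e' -> B T s t e.
Hypothesis B_bounded : forall s, 0 < s ->
  exists M, \forall T \near F, B T s 0 M.
Hypothesis B_stable : forall eps, 0 < eps ->
  exists2 delta, 0 < delta & \forall T \near F, B T delta 0 eps.
Hypothesis B_attractive : forall s eps, 0 < s -> 0 < eps ->
  exists tau, \forall T \near F, B T s tau eps.

(** Each level may be valid on its own [F]-large set of periods; the infimum [gain s t] is therefore
    a function of radius and time alone. *)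
Let levels (s t : R) : set R :=
  [set e | 0 <= e /\ \forall T \near F, B T s t e].

Let gain (s t : R) : R := inf (levels s t).

Let has_lbound_levels s t : has_lbound (levels s t).
Proof. by exists 0 => e []. Qed.

Let levels_nonempty s t : 0 < s -> 0 <= t -> levels s t !=set0.
Proof.
move=> s0 t0; have [M hM] := B_bounded s0; exists `|M|; split=> //.
by apply: filterS hM => T; apply: B_mono; rewrite ?ler_norm.
Qed.

Let gain_ge0 s t : 0 < s -> 0 <= t -> 0 <= gain s t.
Proof.
by move=> s0 t0; apply: lb_le_inf; [exact: levels_nonempty|move=> e []].
Qed.

Let gain_near s t e : 0 < s -> 0 <= t -> gain s t < e ->
  \forall T \near F, B T s t e.
Proof.
move=> s0 t0 /(inf_lt (levels_nonempty s0 t0))[e' [_ he'] e'e].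
by apply: filterS he' => T; apply: B_mono => //; exact: ltW.
Qed.

Let near_gain s t e : 0 <= e -> (\forall T \near F, B T s t e) -> gain s t <= e.
Proof. by move=> e0 he; exact: ge_inf. Qed.

Let gain_le s s' t t' : 0 < s -> s <= s' -> 0 <= t' -> t' <= t ->
  gain s t <= gain s' t'.
Proof.
move=> s0 ss' t'0 t't; apply: lb_le_inf.
  by apply: levels_nonempty => //; exact: lt_le_trans ss'.
move=> e [e0 he]; apply: near_gain => //.
by apply: filterS he => T; exact: B_mono.
Qed.

(* The envelope is taken of the gain at a larger radius and an earlier time, so
   that it dominates the gain at a nearby point of a discrete grid. *)
Let coarse_gain (s t : R) : R := gain (2 * s) (Num.max 0 (t - 1)).

(** The set of good periods for [gain s t] depends on [s] and [t], so a common one is found by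
    compactness: stability handles small radii, attractivity handles late times, and the remaining
    region is covered by a finite grid. *)
Lemma KL_of_bounds : exists2 beta, classKL beta &
  forall Delta nu, 0 < Delta -> 0 < nu ->
  \forall T \near F, forall s t, s <= Delta -> 0 <= t ->
    B T s t (Num.max (beta s t) nu).
Proof.
have max0 (t : R) : 0 <= Num.max 0 (t - 1) by rewrite le_max lexx.
have [||||beta hb coarse_le] := @KL_envelope R coarse_gain.
- by move=> s t s0 t0; rewrite gain_ge0// mulr_gt0.
- move=> s s' t t' s0 ss' t'0 t't.
  by rewrite gain_le ?mulr_gt0 ?ler_pM2l// le_max2// lerD2r.
- move=> eps e0; have [d d0 hd] := B_stable e0; exists (d / 2).
    by rewrite divr_gt0.
  rewrite /coarse_gain mulrC divfK// max_l ?sub0r ?lerN10//.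
  by apply: near_gain => //; exact: ltW.
- move=> s eps s0 e0; have [|tau htau] := @B_attractive (2 * s) eps _ e0.
    by rewrite mulr_gt0.
  exists (`|tau| + 1); first by rewrite addr_ge0.
  rewrite /coarse_gain addrK max_r//; apply: near_gain; first exact: ltW.
  by apply: filterS htau => T; apply: B_mono; rewrite ?ler_norm.
(* The factor 2 absorbs the slack [nu / 2] of the grid bounds: [b + nu / 2] is at most the maximum
   of [2 * b] and [nu]. *)
exists (fun s t => 2 * beta s t); first exact: KL_scale.
move=> Delta nu D0 nu0; have nu20 : 0 < nu / 2 by rewrite divr_gt0.
have [s0 s00 hs0] := B_stable nu0.
have [tau htau] := B_attractive D0 nu0.
pose n := Num.truncn (Delta / s0); pose J := Num.truncn `|tau|.
(* Geometric radii and integer times: rounding the radius up costs at most a factor 2, rounding the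
   time down less than 1, which is exactly what [coarse_gain] allows. *)
pose gs (i : nat) := 2 ^+ i * s0.
have gs0 i : 0 < gs i by rewrite mulr_gt0 ?exprn_gt0.
have hgrid : \forall T \near F, forall ij : 'I_n.+2 * 'I_J.+2,
    B T (gs ij.1) (ij.2 : nat)%:R (gain (gs ij.1) (ij.2 : nat)%:R + nu / 2).
  by apply: filter_forall => -[i j] /=; apply: gain_near; rewrite ?ltrDl.
near=> T => s t sD t0.
have [ss0|s0s] := leP s s0.
  by apply: (@B_mono _ _ s0 _ 0 _ nu) => //; [rewrite le_max lexx orbT|near: T].
have sp : 0 < s by exact: lt_trans s0s.
have [taut|ttau] := leP tau t.
  by apply: (@B_mono _ _ Delta _ tau _ nu) => //;
    [rewrite le_max lexx orbT|near: T].
have DgS : Delta <= gs n.+1.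
  rewrite -ler_pdivrMr//; apply/ltW.
  have /andP[_ /lt_le_trans] := truncn_itv (divr_ge0 (ltW D0) (ltW s00)).
  apply; rewrite -natrX ler_nat; apply: ltnW; exact: ltn_expl.
(* Minimality of the index gives [gs i <= 2 * s]; index zero is excluded because [s0 < s]. *)
have exi : exists i, s <= gs i by exists n.+1; exact: le_trans DgS.
pose i := ex_minn exi.
have [si iSn gsi] : [/\ s <= gs i, (i < n.+2)%N & gs i <= 2 * s].
  rewrite /i; case: ex_minnP => -[|m] hm mmin.
    by move: hm; rewrite /gs expr0 mul1r leNgt s0s.
  split=> //; first by rewrite ltnS mmin// (le_trans sD).
  rewrite /gs exprS -mulrA ler_pM2l// leNgt; apply/negP => /ltW /mmin.
  by rewrite ltnn.
have /andP[jt tj] := truncn_itv t0.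
have jJ : (Num.truncn t < J.+2)%N.
  rewrite ltnS; apply/ltnW; rewrite ltnS.
  by apply: le_truncn; rewrite (le_trans (ltW ttau))// ler_norm.
have : B T (gs i) (Num.truncn t)%:R (gain (gs i) (Num.truncn t)%:R + nu / 2).
  have : forall ij : 'I_n.+2 * 'I_J.+2, B T (gs ij.1) (ij.2 : nat)%:R
    (gain (gs ij.1) (ij.2 : nat)%:R + nu / 2) by near: T.
  by move=> /(_ (Ordinal iSn, Ordinal jJ)).
apply: B_mono => //.
have gb : gain (gs i) (Num.truncn t)%:R <= beta s t.
  rewrite (le_trans _ (coarse_le s t sp t0))// gain_le// ge_max ler0n/=.
  by rewrite lerBlDr natr1 ltW.
rewrite le_max; have [bn|nb] := leP (beta s t) (nu / 2).
  by apply/orP; right; lra.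
by apply/orP; left; lra.
Unshelve. all: by end_near. Qed.

End KLOfBounds.

(** * Composition of solutions and the window argument *)

Section Trajectories.
Variable R : realType.

Lemma phi_add n (S : nat -> 'cV[R]_n -> 'cV[R]_n) k0 i j y0 :
  phi S (k0 + (i + j)) k0 y0 =
  phi S (k0 + i + j) (k0 + i) (phi S (k0 + i) k0 y0).
Proof.
elim: j => [|j IH]; first by rewrite !addn0 phi_init.
by rewrite !addnS !phi_step ?leq_addr// -IH addnA.
Qed.

Lemma phi_zero_input nx nz (f : R -> nat -> 'cV[R]_nx -> 'cV[R]_nz -> 'cV[R]_nx)
    T k k0 x0 :
  phi (zero_input_sys f T) k k0 x0 = phix f T k k0 x0 (fun=> 0).
Proof. by []. Qed.

(** Regarding the driving trajectory as an exogenous input makes the continuity hypothesis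
    applicable to the cascade. *)
Lemma phi_cascade nx nz (f : R -> nat -> 'cV[R]_nx -> 'cV[R]_nz -> 'cV[R]_nx)
    (g : R -> nat -> 'cV[R]_nz -> 'cV[R]_nz) T k0 j xi :
  phi (cascade_sys f g T) (k0 + j) k0 xi =
  col_mx (phix f T (k0 + j) k0 (usubmx xi)
            (fun k => phi (g T) k k0 (dsubmx xi)))
         (phi (g T) (k0 + j) k0 (dsubmx xi)).
Proof.
elim: j => [|j IH]; first by rewrite addn0 /phix !phi_init vsubmxK.
rewrite addnS /phix !phi_step ?leq_addr// IH /cascade_sys.
by rewrite col_mxKu col_mxKd.
Qed.

(** One window takes every value below [Delta] to one below [delta], and a window started below
    [delta] stays below [nu] and ends below [delta] again. Neither [delta] nor [L] depends on
    [T]. *)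
Lemma windowed_bound (beta : R -> R -> R) (Delta nu T1 : R) :
  classKL beta -> 0 < Delta -> 0 < nu -> 0 < T1 ->
  exists2 delta, 0 < delta & exists2 L, 0 < L &
  forall T (a : nat -> R), 0 < T < T1 -> (forall i, 0 <= a i) ->
    (forall i j, a i <= Delta -> j%:R * T <= L ->
       a (i + j)%N <= Num.max (beta (a i) (j%:R * T)) delta) ->
    a 0 <= Delta ->
    forall j, a j <= Num.max (beta (a 0) (j%:R * T)) nu.
Proof.
move=> hb D0 nu0 T10; have [d1 d10 hd1] := KL_small hb nu0.
(* Below [nu] to meet the final bound, below [Delta] to allow a restart, below [d1] to keep the KL
   term under [nu] after the restart. *)
pose delta := Num.min (Num.min nu Delta) d1.
have d0 : 0 < delta by rewrite !lt_min nu0 D0.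
have dnu : delta <= nu by rewrite !ge_min lexx.
have dD : delta <= Delta by rewrite !ge_min lexx orbT.
have dd1 : delta <= d1 by rewrite ge_min lexx orbT.
have [tau tau0 htau] := KL_vanish hb (ltW D0) d0.
(* The extra [T1] leaves room for a whole number [N] of steps with [tau <= N%:R * T <= L], whatever
   the period below [T1]. *)
pose L := tau + T1; exists delta => //; exists L; first by rewrite addr_gt0.
move=> T a /andP[T0 TT1] a0 ha aD.
have LT0 : 0 <= L / T by rewrite divr_ge0 ?addr_ge0// ltW.
pose N := Num.truncn (L / T).
have /andP[NL LN] := truncn_itv LT0.
have {}NL : N%:R * T <= L by rewrite -ler_pdivlMr.
have {}LN : tau <= N%:R * T.
  move: LN; rewrite ltr_pdivrMr// -natr1 mulrDl mul1r /L; lra.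
have N0 : (0 < N)%N.
  by rewrite lt0n; apply/eqP => Nz; move: LN; rewrite Nz mul0r leNgt tau0.
have jN j : (j <= N)%N -> j%:R * T <= L.
  by move=> jN; rewrite (le_trans _ NL)// ler_pM2r// ler_nat.
have back i : a i <= Delta -> a (i + N)%N <= delta.
  move=> ai; rewrite (le_trans (ha _ _ ai NL))// ge_max lexx andbT.
  by rewrite (le_trans _ htau)// KL_le// ltW.
(* Strong induction on the elapsed steps, removing one window of [N] steps at a time. *)
have stay j i : a i <= delta -> a (i + j)%N <= nu.
  elim/ltn_ind: j i => j IH i ai; have aiD := le_trans ai dD.
  have [/jN jL|/ltnW Nj] := leqP j N.
    rewrite (le_trans (ha _ _ aiD jL))// ge_max dnu andbT.
    by rewrite (le_trans _ hd1)// KL_le ?(le_trans ai)// mulr_ge0// ltW.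
  rewrite -(subnKC Nj) addnA; apply: IH; last exact: back.
  by rewrite ltn_subrL N0 (leq_trans N0).
move=> j; have [/jN jL|/ltnW Nj] := leqP j N.
  by rewrite (le_trans (ha 0 j aD jL))// le_max2.
by rewrite le_max -(subnKC Nj) stay ?orbT// (back 0).
Qed.

End Trajectories.

(** * Both directions of the equivalence, for a general filter of sampling periods *)

Section Filtered.
Variables (R : realType) (F : set_system R).

(* The semiglobal and global notions are both instances of the following ones:
   [F] is the filter of punctured right neighbourhoods of 0 in the semiglobal
   case, and the principal filter of a fixed interval of sampling periods in
   the global case. *)
Definition filtered_UAS_with (beta : R -> R -> R) n
    (S : Defs.family R n) : Prop :=
  forall Delta nu : R, 0 < Delta -> 0 < nu ->
  \forall T \near F, forall (k0 : nat) (y0 : 'cV[R]_n) (j : nat),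
    enorm y0 <= Delta ->
    enorm (phi (S T) (k0 + j) k0 y0)
      <= Num.max (beta (enorm y0) (j%:R * T)) nu.

Definition filtered_UAS n (S : Defs.family R n) : Prop :=
  exists2 beta, classKL beta & filtered_UAS_with beta S.

Definition filtered_UB n (S : Defs.family R n) : Prop :=
  forall Delta : R, 0 < Delta -> exists M : R,
  \forall T \near F, forall (k0 : nat) (y0 : 'cV[R]_n) (j : nat),
    enorm y0 <= Delta -> enorm (phi (S T) (k0 + j) k0 y0) <= M.

Variables nx nz : nat.
Variable f : R -> nat -> 'cV[R]_nx -> 'cV[R]_nz -> 'cV[R]_nx.
Variable g : R -> nat -> 'cV[R]_nz -> 'cV[R]_nz.

Definition filtered_UC : Prop :=
  forall eta eps L : R, 0 < eta -> 0 < eps -> 0 < L ->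
  exists2 mu : R, 0 < mu &
  \forall T \near F, forall (w : nat -> 'cV[R]_nz) k0 (x0 : 'cV[R]_nx) j,
    (forall i, enorm (w (k0 + i)%N) <= mu) -> enorm x0 <= eta ->
    j%:R * T <= L ->
    enorm (phix f T (k0 + j) k0 x0 w - phix f T (k0 + j) k0 x0 (fun=> 0))
      <= eps.

Context {FF : Filter F}.
Variable T1 : R.
Hypothesis T1_gt0 : 0 < T1.
Hypothesis near_T1 : \forall T \near F, 0 < T < T1.
Hypothesis f_UC : filtered_UC.

(** The sum is at most twice the larger of [e] and [d / 2]; an additive comparison error becomes a
    maximum at the price of doubling the KL function. *)
Lemma max_half_add (b d e : R) :
  b <= Num.max e (d / 2) -> b + d / 2 <= Num.max (2 * e) d.
Proof.
rewrite !le_max => /orP[be|bd]; last by apply/orP; right; lra.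
have [ed|de] := leP e (d / 2); [apply/orP; right|apply/orP; left]; lra.
Qed.

(** On each window the forced solution is within [d / 2] of the unforced one restarted at the same
    state, which yields the window estimate for [2 * beta]. *)
Lemma small_input_bound beta : classKL beta ->
    filtered_UAS_with beta (zero_input_sys f) ->
  forall Delta nu, 0 < Delta -> 0 < nu -> exists2 mu, 0 < mu &
  \forall T \near F, forall (w : nat -> 'cV[R]_nz) k0 (x0 : 'cV[R]_nx) j,
    (forall i, enorm (w (k0 + i)%N) <= mu) -> enorm x0 <= Delta ->
    enorm (phix f T (k0 + j) k0 x0 w)
      <= Num.max (2 * beta (enorm x0) (j%:R * T)) nu.
Proof.
move=> hb hx Delta nu D0 nu0.
have [d d0 [L L0 hL]] :=
  windowed_bound (KL_scale (ltr0Sn R 1) hb) D0 nu0 T1_gt0.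
have d20 : 0 < d / 2 by rewrite divr_gt0.
have [mu mu0 hmu] := f_UC D0 d20 L0; exists mu => //.
apply: filterS3 near_T1 hmu (hx _ _ D0 d20) => T TT1 hmuT hxT w k0 x0 j hw x0D.
have := hL T (fun j => enorm (phix f T (k0 + j) k0 x0 w)).
rewrite /= addn0 [phix _ _ k0 _ _ _]phi_init; apply => // [i|i {}j iD jL].
  exact: enorm_ge0.
rewrite /phix phi_add -/(phix f T _ _ _ _); set x1 := phi _ (k0 + i) k0 x0.
apply: le_trans (max_half_add (hxT (k0 + i)%N x1 j iD)); rewrite addrC.
set x := phix _ _ _ _ _ w; set y := phix f T (k0 + i + j) (k0 + i) x1 (fun=> 0).
rewrite -[x](subrK y).
rewrite (le_trans (enormD _ _))// lerD// hmuT// => m.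
by rewrite -addnA.
Qed.

Lemma filtered_UAS_cascade : filtered_UAS (zero_input_sys f) ->
  filtered_UAS g -> filtered_UB (cascade_sys f g) ->
  filtered_UAS (cascade_sys f g).
Proof.
move=> [bx hbx hx] [bz hbz hz] hB.
pose B T s t e := forall k0 (y0 : 'cV[R]_(nx + nz)) j,
  enorm y0 <= s -> t <= j%:R * T ->
  enorm (phi (cascade_sys f g T) (k0 + j) k0 y0) <= e.
have [||||beta hb hbeta] := @KL_of_bounds R F FF B.
- move=> T s s' t t' e e' ss' t't e'e hBT k0 y0 j y0s tj.
  by rewrite (le_trans _ e'e)// hBT ?(le_trans y0s)// (le_trans t't).
- move=> s /hB[M hM]; exists M.
  by apply: filterS hM => T hM k0 y0 j y0s _; exact: hM.
(* Stability: a small start keeps [z] below [mu] for all times, so the small-input bound for [x]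
   applies from [k0]. The cap at 1 is the radius for which the [x] and [z] bounds are requested. *)
- move=> eps e0; have e20 : 0 < eps / 2 by rewrite divr_gt0.
  have [mu mu0 hmu] := small_input_bound hbx hx (ltr01 : 0 < 1) e20.
  have m0 : 0 < Num.min mu (eps / 2) by rewrite lt_min mu0.
  have [d1 d10 hd1] := KL_small (KL_scale (ltr0Sn R 1) hbx) e20.
  have [d2 d20 hd2] := KL_small hbz m0.
  exists (Num.min (Num.min d1 d2) 1); first by rewrite !lt_min d10 d20 ltr01.
  apply: filterS3 near_T1 hmu (hz _ _ (ltr01 : 0 < 1) m0).
  move=> T /andP[T0 _] hmuT hzT k0 y0 j.
  rewrite !le_min => /andP[/andP[y0d1 y0d2] y01] _.
  have tT i : 0 <= i%:R * T by rewrite mulr_ge0// ltW.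
  have zm i : enorm (phi (g T) (k0 + i) k0 (dsubmx y0)) <= Num.min mu (eps / 2).
    have z1 := le_trans (enorm_dsubmx y0) y01.
    rewrite (le_trans (hzT _ _ i z1))// ge_max lexx andbT.
    rewrite (le_trans _ hd2)// KL_le ?enorm_ge0//.
    exact: le_trans (enorm_dsubmx y0) y0d2.
  rewrite phi_cascade (le_trans (enorm_col_mx _ _))// [leRHS]splitr lerD//.
    rewrite (le_trans (hmuT _ _ _ _ _ _))//.
    + by move=> i; rewrite (le_trans (zm i))// ge_min lexx.
    + exact: le_trans (enorm_usubmx y0) y01.
    rewrite ge_max lexx andbT (le_trans _ hd1)// ler_pM2l//.
    rewrite KL_le ?enorm_ge0//; exact: le_trans (enorm_usubmx y0) y0d1.
  by rewrite (le_trans (zm j))// ge_min lexx orbT.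
(* Attractivity: wait until [z] is below [mu], when [x] is still bounded by [M], then apply the
   small-input bound from that state. *)
- move=> s eps s0 e0; have e20 : 0 < eps / 2 by rewrite divr_gt0.
  have [M hM] := hB s s0.
  have M0 : 0 < `|M| + 1 by rewrite ltr_wpDl.
  have [mu mu0 hmu] := small_input_bound hbx hx M0 e20.
  have m0 : 0 < Num.min mu (eps / 2) by rewrite lt_min mu0.
  have [t1 t10 ht1] := KL_vanish hbz (ltW s0) m0.
  have [t2 t20 ht2] := KL_vanish (KL_scale (ltr0Sn R 1) hbx) (ltW M0) e20.
  (* The summand [T1] pays for rounding [t1] up to a whole number of steps. *)
  exists (t1 + T1 + t2).
  apply: filterS3 (filterI near_T1 hmu) (hz _ _ s0 m0) hM.
  move=> T [/andP[T0 TT1] hmuT] hzT hMT k0 y0 j y0s tj.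
  have zm i : t1 <= i%:R * T ->
      enorm (phi (g T) (k0 + i) k0 (dsubmx y0)) <= Num.min mu (eps / 2).
    move=> t1i; have zs := le_trans (enorm_dsubmx y0) y0s.
    rewrite (le_trans (hzT _ _ i zs))// ge_max lexx andbT.
    by rewrite (le_trans _ ht1)// KL_le ?enorm_ge0// ltW.
  pose N := (Num.truncn (t1 / T)).+1.
  have /andP[NT TN] := truncn_itv (divr_ge0 (ltW t10) (ltW T0)).
  have {}TN : t1 <= N%:R * T by rewrite -ler_pdivrMr// ltW.
  have {}NT : N%:R * T <= t1 + T.
    by rewrite /N -natr1 mulrDl mul1r lerD2r -ler_pdivlMr.
  have Nj : (N <= j)%N.
    by rewrite -(ler_nat R) -(ler_pM2r T0); lra.
  rewrite phi_cascade (le_trans (enorm_col_mx _ _))// [leRHS]splitr lerD//.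
    rewrite /phix -[in X in phi _ X](subnKC Nj) phi_add -/(phix f T _ _ _ _).
    set x1 := phi _ (k0 + N) k0 _.
    have x1M : enorm x1 <= `|M| + 1.
      have := hMT k0 y0 N y0s; rewrite phi_cascade => hN.
      have := enorm_usubmx (col_mx x1 (phi (g T) (k0 + N) k0 (dsubmx y0))).
      rewrite col_mxKu => /le_trans/(_ hN)/le_trans; apply.
      by rewrite (le_trans (ler_norm M))// lerDl.
    rewrite (le_trans (hmuT _ _ _ _ _ x1M))//.
      move=> i; rewrite -addnA (le_trans (zm _ _)) ?ge_min ?lexx//.
      by rewrite (le_trans TN)// ler_pM2r// ler_nat leq_addr.
    rewrite ge_max lexx andbT (le_trans _ ht2)// ler_pM2l//.
    rewrite KL_le ?enorm_ge0 ?(ltW t20)//.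
    by rewrite natrB// mulrBl; lra.
  by rewrite (le_trans (zm _ _)) ?ge_min ?lexx ?orbT//; lra.
exists beta => // Delta nu D0 nu0.
apply: filterS2 near_T1 (hbeta _ _ D0 nu0) => T /andP[T0 _] hT k0 y0 j y0D.
by apply: hT => //; rewrite mulr_ge0// ltW.
Qed.

(** Within each window the unforced solution is compared with the cascade started at the current [x]
    and at [z = 0]. *)
Lemma filtered_UAS_zero_input :
  filtered_UAS (cascade_sys f g) -> filtered_UAS (zero_input_sys f).
Proof.
move=> [beta hb hc]; have h2b := KL_scale (ltr0Sn R 1) hb.
exists (fun s t => 2 * beta s t) => // Delta nu D0 nu0.
have [d d0 [L L0 hL]] := windowed_bound h2b D0 nu0 T1_gt0.
have d20 : 0 < d / 2 by rewrite divr_gt0.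
have [mu mu0 hmu] := f_UC D0 d20 L0.
have m0 : 0 < Num.min mu (d / 2) by rewrite lt_min mu0.
apply: filterS3 near_T1 hmu (hc _ _ D0 m0) => T TT1 hmuT hcT k0 x0 j x0D.
have T0 : 0 < T by case/andP: TT1.
have := hL T (fun j => enorm (phi (zero_input_sys f T) (k0 + j) k0 x0)).
rewrite /= addn0 phi_init; apply => // [i|i {}j iD jL]; first exact: enorm_ge0.
rewrite phi_add; set x1 := phi _ (k0 + i) k0 x0; move: iD; rewrite -/x1.
move: (k0 + i)%N x1 => k1 x1 x1D.
(* The origin need not be an equilibrium of [g T], so this input may be nonzero; the cascade
   estimate from the zero state bounds it by [mu]. *)
pose w k := phi (g T) k k1 0.
have w_small m : enorm (w (k1 + m)%N) <= mu.
  have := hcT k1 0 m; rewrite phi_cascade enorm0 (ltW D0) KL0// => [/(_ isT)|].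
    move=> /(le_trans (enorm_dsubmx _)); rewrite col_mxKd max_r ?(ltW m0)//.
    by rewrite linear0 => /le_trans; apply; rewrite ge_min lexx.
  by rewrite mulr_ge0// ltW.
have := hcT k1 (col_mx x1 0) j; rewrite enorm_colmx0 => /(_ x1D).
rewrite phi_cascade col_mxKu col_mxKd => /(le_trans (enorm_usubmx _)).
rewrite col_mxKu -/w => x_le.
apply: (@le_trans _ _ (enorm (phix f T (k1 + j) k1 x1 w) + d / 2)).
  rewrite phi_zero_input -[X in enorm X](subKr (phix f T (k1 + j) k1 x1 w)).
  by rewrite (le_trans (enormD _ _))// enormN lerD// hmuT.
by rewrite max_half_add// (le_trans x_le)// le_max2// ge_min lexx orbT.
Qed.

End Filtered.

(** * Specialization to the semiglobal and global notions *)

Section SemiglobalAndGlobal.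
Variable R : realType.

Lemma near_right0P (P : set R) :
  (\forall T \near 0^'+, P T) <->
  exists2 Tstar, 0 < Tstar & forall T, 0 < T < Tstar -> P T.
Proof.
split=> [/nbhs_ballP[e /= e0 he]|[e e0 he]].
  exists e => // T /andP[T0 Te]; apply: he => //.
  by rewrite /ball/= sub0r normrN gtr0_norm.
near=> T; apply: he; apply/andP; split; near: T.
- exact: nbhs_right_gt.
- exact: nbhs_right_lt.
Unshelve. all: by end_near. Qed.

Lemma SP_UASP n (S : Defs.family R n) : SP_UAS S <-> filtered_UAS 0^'+ S.
Proof.
split=> -[beta hb hS]; exists beta => // Delta nu D0 nu0.
  apply/near_right0P; have [Ts Ts0 hT] := hS _ _ D0 nu0; exists Ts => // T TTs.
  move=> k0 y0 j y0D; have := hT k0 y0 T (k0 + j)%N y0D TTs (leq_addr _ _).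
  by rewrite addKn.
have /near_right0P[Ts Ts0 hT] := hS _ _ D0 nu0; exists Ts => //.
move=> k0 y0 T k y0D TTs k0k.
by have := hT T TTs k0 y0 (k - k0)%N y0D; rewrite subnKC.
Qed.

Lemma USB_filtered n (S : Defs.family R n) : USB S -> filtered_UB 0^'+ S.
Proof.
move=> [kappa hk [c hS]] Delta D0; exists (kappa Delta + c).
have [Ts Ts0 hT] := hS _ D0; apply/near_right0P; exists Ts => // T TTs.
move=> k0 y0 j y0D; rewrite (le_trans (hT _ _ _ _ y0D TTs (leq_addr _ _)))//.
by rewrite lerD2r Koo_le// enorm_ge0.
Qed.

Lemma SP_UAS_USB n (S : Defs.family R n) : SP_UAS S -> USB S.
Proof.
move=> [beta hb hS]; exists (fun s => beta s 0 + s); first exact: KL_Koo.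
exists 1 => Delta D0; have [Ts Ts0 hT] := hS _ _ D0 ltr01; exists Ts => //.
move=> k0 y0 T k y0D TTs k0k; have T0 : 0 < T by case/andP: TTs.
have b0 : 0 <= beta (enorm y0) 0 by rewrite KL_ge0// enorm_ge0.
rewrite (le_trans (hT _ _ _ _ y0D TTs k0k))// ge_max; apply/andP; split.
  rewrite -addrA ler_wpDr ?addr_ge0 ?enorm_ge0// KL_le ?enorm_ge0//.
  by rewrite mulr_ge0// ltW.
by rewrite lerDr addr_ge0 ?enorm_ge0.
Qed.

(** Allowing every [T1] below the threshold lets the thresholds of several hypotheses be replaced by
    their minimum. *)
Lemma UGAS_filtered n (S : Defs.family R n) : UGAS S ->
  exists2 Tstar, 0 < Tstar & forall T1, T1 <= Tstar ->
    filtered_UAS (globally [set T | 0 < T < T1]) S.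
Proof.
move=> [beta hb [Ts Ts0 hT]]; exists Ts => // T1 T1s; exists beta => //.
move=> Delta nu _ _ T /andP[T0 TT1] k0 y0 j _.
have TTs : 0 < T < Ts by rewrite T0 (lt_le_trans TT1).
have := hT k0 y0 T (k0 + j)%N TTs (leq_addr _ _).
by rewrite addKn le_max => ->.
Qed.

(** With a principal filter the admissible periods do not depend on [Delta] and [nu], so [nu] can
    tend to zero at a fixed period. *)
Lemma filtered_UGAS n (S : Defs.family R n) T1 : 0 < T1 ->
  filtered_UAS (globally [set T | 0 < T < T1]) S -> UGAS S.
Proof.
move=> T10 [beta hb hS]; exists beta => //; exists T1 => // k0 y0 T k TT1 k0k.
have T0 : 0 < T by case/andP: TT1.
have b0 : 0 <= beta (enorm y0) ((k - k0)%:R * T).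
  by rewrite KL_ge0 ?enorm_ge0// mulr_ge0// ltW.
apply/ler_addgt0Pr => e e0.
have D0 : 0 < enorm y0 + 1 by rewrite ltr_wpDl ?enorm_ge0.
have := hS _ _ D0 e0 T TT1 k0 y0 (k - k0)%N; rewrite lerDl ler01 subnKC//.
move=> /(_ isT)/le_trans; apply.
by rewrite ge_max lerDl lerDr b0 ltW.
Qed.

Lemma UGB_filtered n (S : Defs.family R n) : UGB S ->
  exists2 Tstar, 0 < Tstar & forall T1, T1 <= Tstar ->
    filtered_UB (globally [set T | 0 < T < T1]) S.
Proof.
move=> [kappa hk [c [Ts Ts0 hT]]]; exists Ts => // T1 T1s Delta D0.
exists (kappa Delta + c) => T /andP[T0 TT1] k0 y0 j y0D.
have TTs : 0 < T < Ts by rewrite T0 (lt_le_trans TT1).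
rewrite (le_trans (hT _ _ _ _ TTs (leq_addr _ _)))//.
by rewrite lerD2r Koo_le// enorm_ge0.
Qed.

Lemma UGAS_UGB n (S : Defs.family R n) : UGAS S -> UGB S.
Proof.
move=> [beta hb [Ts Ts0 hT]]; exists (fun s => beta s 0 + s).
  exact: KL_Koo.
exists 0, Ts => // k0 y0 T k TTs k0k; have T0 : 0 < T by case/andP: TTs.
rewrite (le_trans (hT _ _ _ _ TTs k0k))// addr0 ler_wpDr ?enorm_ge0//.
by rewrite KL_le ?enorm_ge0// mulr_ge0// ltW.
Qed.

Variables nx nz : nat.
Variable f : R -> nat -> 'cV[R]_nx -> 'cV[R]_nz -> 'cV[R]_nx.
Variable g : R -> nat -> 'cV[R]_nz -> 'cV[R]_nz.

Lemma close_to_zero_input_window Tstar eta eps L mu :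
  close_to_zero_input f Tstar eta eps L mu ->
  forall T (w : nat -> 'cV[R]_nz) k0 (x0 : 'cV[R]_nx) j, 0 < T < Tstar ->
    (forall i, enorm (w (k0 + i)%N) <= mu) -> enorm x0 <= eta ->
    j%:R * T <= L ->
    enorm (phix f T (k0 + j) k0 x0 w - phix f T (k0 + j) k0 x0 (fun=> 0))
      <= eps.
Proof.
move=> hc T w k0 x0 j TTs hw x0e jL; apply: hc; rewrite ?leq_addr//.
  apply: ge_ereal_sup => _ [k /= k0k <-]; rewrite lee_fin -(subnKC k0k).
  exact: hw.
rewrite PoszD lerD2l floor_ge_int ler_pdivlMr//.
by case/andP: TTs.
Qed.

Lemma USC_filtered : USC f -> filtered_UC 0^'+ f.
Proof.
move=> hU eta eps L eta0 eps0 L0.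
(* USC requires [eta] strictly below its radius, hence the doubled one. *)
have [Ts Ts0 hT] := hU (2 * eta) (mulr_gt0 (ltr0Sn _ 1) eta0).
have [|mu mu0 hmu] := hT eta eps L _ eps0 L0; first by rewrite eta0; lra.
exists mu => //; apply/near_right0P; exists Ts => // T TTs w k0 x0 j.
exact: close_to_zero_input_window hmu _ _ _ _ _ TTs.
Qed.

Lemma UGC_filtered : UGC f ->
  exists2 Tstar, 0 < Tstar & forall T1, T1 <= Tstar ->
    filtered_UC (globally [set T | 0 < T < T1]) f.
Proof.
move=> [Ts Ts0 hT]; exists Ts => // T1 T1s eta eps L eta0 eps0 L0.
have [mu mu0 hmu] := hT eta eps L eta0 eps0 L0.
exists mu => // T /andP[T0 TT1] w k0 x0 j.
apply: close_to_zero_input_window hmu _ _ _ _ _ _.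
by rewrite T0 (lt_le_trans TT1).
Qed.

(** Starting the cascade at [x = 0] makes its initial norm equal to that of [z0], so its estimates
    pass to (Z) with the same KL function. *)
Lemma enorm_driving_le T k0 j (z0 : 'cV[R]_nz) :
  enorm (phi (g T) (k0 + j) k0 z0)
    <= enorm (phi (cascade_sys f g T) (k0 + j) k0 (col_mx 0 z0)).
Proof.
rewrite phi_cascade col_mxKd (le_trans _ (enorm_dsubmx _))//.
by rewrite col_mxKd.
Qed.

Lemma SP_UAS_driving : SP_UAS (cascade_sys f g) -> SP_UAS g.
Proof.
move=> [beta hb hS]; exists beta => // Delta nu D0 nu0.
have [Ts Ts0 hT] := hS _ _ D0 nu0; exists Ts => // k0 z0 T k z0D TTs k0k.
have := hT k0 (col_mx 0 z0) T k; rewrite enorm_col0mx => /(_ z0D TTs k0k).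
by apply: le_trans; rewrite -(subnKC k0k) enorm_driving_le.
Qed.

Lemma UGAS_driving : UGAS (cascade_sys f g) -> UGAS g.
Proof.
move=> [beta hb [Ts Ts0 hT]]; exists beta => //; exists Ts => //.
move=> k0 z0 T k TTs k0k.
have := hT k0 (col_mx 0 z0) T k; rewrite enorm_col0mx => /(_ TTs k0k).
by apply: le_trans; rewrite -(subnKC k0k) enorm_driving_le.
Qed.

Lemma SP_UAS_cascade : USC f ->
  (SP_UAS (cascade_sys f g) <->
   SP_UAS (zero_input_sys f) /\ SP_UAS g /\ USB (cascade_sys f g)).
Proof.
move=> /USC_filtered hU.
have near1 : \forall T \near (0 : R)^'+, 0 < T < 1.
  by apply/near_right0P; exists 1.
split=> [hS|[/SP_UASP hX [/SP_UASP hZ /USB_filtered hB]]].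
  split; last by split; [exact: SP_UAS_driving|exact: SP_UAS_USB].
  apply/SP_UASP; apply: (filtered_UAS_zero_input ltr01 near1 hU (g := g)).
  exact/SP_UASP.
exact/SP_UASP/(filtered_UAS_cascade ltr01 near1 hU hX hZ hB).
Qed.

Lemma UGAS_cascade : UGC f ->
  (UGAS (cascade_sys f g) <->
   UGAS (zero_input_sys f) /\ UGAS g /\ UGB (cascade_sys f g)).
Proof.
move=> /UGC_filtered[T1 T10 hU].
split=> [hS|[/UGAS_filtered[T2 T20 hX] [/UGAS_filtered[T3 T30 hZ]]]].
  split; last by split; [exact: UGAS_driving|exact: UGAS_UGB].
  have [T2 T20 hC] := UGAS_filtered hS.
  have T0 : 0 < Num.min T1 T2 by rewrite lt_min T10.
  apply: (filtered_UGAS T0).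
  apply: (filtered_UAS_zero_input T0 _ _ (g := g)) => //.
  - by apply: hU; rewrite ge_min lexx.
  - by apply: hC; rewrite ge_min lexx orbT.
move=> /UGB_filtered[T4 T40 hB].
pose Tm := Num.min (Num.min T1 T2) (Num.min T3 T4).
have T0 : 0 < Tm by rewrite !lt_min T10 T20 T30.
apply: (filtered_UGAS T0); apply: (filtered_UAS_cascade T0 _ _) => //.
- by apply: hU; rewrite !ge_min lexx.
- by apply: hX; rewrite !ge_min lexx !orbT.
- by apply: hZ; rewrite !ge_min lexx !orbT.
- by apply: hB; rewrite !ge_min lexx !orbT.
Qed.

End SemiglobalAndGlobal.

Theorem theorem2 (R : realType) (nx nz : nat)
    (f : R -> nat -> 'cV[R]_nx -> 'cV[R]_nz -> 'cV[R]_nx)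
    (g : R -> nat -> 'cV[R]_nz -> 'cV[R]_nz) :
  (USC f ->
     (SP_UAS (cascade_sys f g) <->
        SP_UAS (zero_input_sys f) /\ SP_UAS g /\ USB (cascade_sys f g))) /\
  (UGC f ->
     (UGAS (cascade_sys f g) <->
        UGAS (zero_input_sys f) /\ UGAS g /\ UGB (cascade_sys f g))).
Proof. by split; [exact: SP_UAS_cascade|exact: UGAS_cascade]. Qed.
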